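(* Let $X$ be a Banach space and let $f\colon B_X \to B_X$ be a non-expansive homeomorphism that is not an isometry. Then $X$ has a separable closed subspace $Y$ such that $f(B_Y) = B_Y$ and the restriction $\rho := f|_{B_Y}\colon B_Y \to B_Y$ is a non-expansive homeomorphism that is not an isometry.
   Context: For a Banach space $X$, $B_X$ denotes its closed unit ball; for a closed subspace $Y$ of $X$, $B_Y = Y \cap B_X$. A map $f$ between metric spaces is non-expansive if it is 1-Lipschitz, i.e. $d(f(x),f(y)) \le d(x,y)$ for all $x,y$. *)

(* Defs.v *)
From mathcomp Require Import all_boot all_order all_algebra.
From mathcomp Require Import all_classical all_reals all_analysis.
From mathcomp Require Import complex.

Set Implicit Arguments.
Unset Strict Implicit.
Unset Printing Implicit Defensive.

Import Order.TTheory GRing.Theory Num.Theory.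
Import numFieldNormedType.Exports.

Local Open Scope classical_set_scope.
Local Open Scope ring_scope.

(* Banach spaces are taken over the real or over the complex numbers. *)
Variant scalars := RealScalars | ComplexScalars.

Definition scalar_field (R : realType) (s : scalars) : numFieldType :=
  match s with
  | RealScalars => R
  | ComplexScalars => complex R
  end.

Section Definitions.
Context {K : numFieldType} {X : normedModType K}.
Implicit Types (A B Y : set X) (f : X -> X).

(* The library's [closed_ball x r] is the closure of an open ball; its
   description by the norm is only available over real scalars. *)
Definition unit_ball : set X := closed_ball_ Num.norm 0 1.

Definition closed_subspace Y := closed Y /\ submod_closed [in Y].

(* For [D `<=` A], [A `<=` closure D] says that [D] is dense in the subspace [A]. *)
Definition separable_set A :=
  exists D, [/\ countable D, D `<=` A & A `<=` closure D].

(* A map [A -> B] is represented by a total function of which only the values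
   on [A] matter; restricting the map to a subset of [A] leaves [f] unchanged.
   The notions below depend only on the values of [f] on [A]. *)
Definition homeomorphism_on A B f :=
  [/\ set_bij A B f, {within A, continuous f} &
      exists g : X -> X, {in A, cancel f g} /\ {within B, continuous g}].

Definition nonexpansive_on A f := 1.-lipschitz_A f.

Definition isometry_on A f :=
  forall x y, A x -> A y -> `|f x - f y| = `|x - y|.

End Definitions.

Arguments unit_ball {K} X.

(* Main.v *)
Require Import Defs.
From mathcomp Require Import all_boot all_order all_algebra.
From mathcomp Require Import all_classical all_reals all_analysis.
From mathcomp Require Import complex lra.

(** The subspace [Y] is the closure of a countable set [D] that contains [0] and
two points [x], [y] of the unit ball whose distance [f] does not preserve.

Call [g] the inverse of [f] on the ball.  Composing [f] and [g] with the radial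
retraction [r] of the space onto its ball gives maps [f \o r] and [g \o r] that
are continuous on the whole space and agree with [f] and [g] on the ball.  Take
for [D] a countable set closed under these two maps and under the operations
[b *: u + v] with [b] in a countable dense set of scalars; it is obtained by
closing off a finite set under countably many operations
([countable_closed_hull]).  By continuity its closure [Y] is stable under
[f \o r] and [g \o r] ([closure_stable]) and under all linear combinations
([closure_submod]).  Stability under [f \o r] and [g \o r] says that [f] and [g]
both map the ball of [Y] into itself, so [f] maps it onto itself.  The retraction
avoids having to show that points of [Y] in the ball are limits of points of [D]
in the ball.

The real and the complex case differ only in the existence of a countable dense
set of scalars ([scalar_field_separable]). *)

Set Implicit Arguments.
Unset Strict Implicit.
Unset Printing Implicit Defensive.

Import Order.TTheory GRing.Theory Num.Theory.
Import numFieldNormedType.Exports.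

Local Open Scope classical_set_scope.
Local Open Scope ring_scope.

Lemma countable_setU T (A B : set T) :
  countable A -> countable B -> countable (A `|` B).
Proof.
by move=> cA cB; rewrite -bigcup2E; apply: bigcup_countable => // -[|[|i]].
Qed.

(** The set [D] is the union of the stages of the closing-off process.  The stages
increase, so two elements of [D] lie in a common stage, and the next stage
contains their image. *)
Lemma countable_closed_hull T (A : set T) (O : set (T -> T -> T)) :
  countable A -> countable O ->
  exists D, [/\ countable D, A `<=` D &
    forall o x y, O o -> D x -> D y -> D (o x y)].
Proof.
move=> cA cO.
pose step B := B `|` (fun t : (T -> T -> T) * (T * T) => t.1 t.2.1 t.2.2) @`
  (O `*` (B `*` B)).
have step_sub m n : (m <= n)%N -> iter m step A `<=` iter n step A.
  elim: n => [|n IH]; first by rewrite leqn0 => /eqP ->.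
  by rewrite leq_eqVlt => /predU1P[->//|/IH mn] x /mn ?; left.
exists (\bigcup_n iter n step A); split.
- apply: bigcup_countable => // n _; elim: n => //= n IH.
  apply: countable_setU => //; apply: sub_countable (card_image_le _ _) _.
  by do 2?apply: countableX.
- by move=> x Ax; exists 0%N.
- move=> o x y Oo [m _ mx] [n _ ny]; exists (maxn m n).+1 => //=; right.
  exists (o, (x, y)) => //=; split => //; split => /=.
    by apply: step_sub mx; rewrite leq_maxl.
  by apply: step_sub ny; rewrite leq_maxr.
Qed.

(** Over the complex numbers the dense set consists of the [p + i q] with [p], [q]
rational: approximating both coordinates within [e / 2] gives distance below
[e]. *)
Lemma scalar_field_separable (R : realType) (s : scalars) :
  exists2 E : set (scalar_field R s), countable E & dense E.
Proof.
case: s => /=.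
  exists (range (ratr : rat -> R)); last exact: dense_rat.
  by apply: sub_countable (card_image_le _ _) _.
exists (range (fun p : rat * rat => Complex (ratr p.1) (ratr p.2) : complex R)).
  by apply: sub_countable (card_image_le _ _) _.
move=> O [[a b] Oab] oO.
have := oO; rewrite openE => /(_ _ Oab) /nbhs_ballP[[e i] /=].
(* a positive complex number is a positive real *)
rewrite ltcE /= => /andP[/eqP -> e0 eO].
have e20 : 0 < e / 2 by rewrite divr_gt0.
have approx (x : R) : exists q, `|x - ratr q| < e / 2.
  have /rat_in_itvoo[q /itvP qx] : x - e / 2 < x + e / 2.
    by rewrite ltrBlDr -addrA ltrDl addr_gt0.
  by exists (q : rat); rewrite distrC ltr_distl !qx.
have [q aq] := approx a; have [r br] := approx b.
exists (Complex (ratr q) (ratr r)); split; last by exists (q, r).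
apply: eO; rewrite /ball /= normc_def ltcR /= -[ltRHS]gtr0_norm// -sqrtr_sqr.
have small_sqr (x : R) : `|x| < e / 2 -> x ^+ 2 < e ^+ 2 / 2.
  by rewrite ltr_norml => /andP[]; nra.
by rewrite ltr_sqrt ?exprn_gt0// [ltRHS]splitr ltrD ?small_sqr.
Qed.

Lemma closure_stable (T : topologicalType) (F : T -> T) (D : set T) :
  continuous F -> (forall x, D x -> D (F x)) ->
  forall x, closure D x -> closure D (F x).
Proof.
move=> cF DF x xD B nB; have [y [Dy By]] := xD _ (cF _ _ nB).
by exists (F y); split => //; exact: DF.
Qed.

Section NormedModule.
Context {K : numFieldType} {X : normedModType K}.

(** The map [x |-> x / max 1 |x|].  The scalars need not be totally ordered, so the
maximum is written as [(1 + |x| + | |x| - 1 |) / 2]; this also makes continuity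
immediate. *)
Definition radial_retraction (x : X) : X :=
  (2 / (1 + `|x| + `| `|x| - 1 |)) *: x.

Let den_gt0 (x : X) : 0 < 1 + `|x| + `| `|x| - 1 |.
Proof. by rewrite ltr_wpDr// ltr_wpDr. Qed.

Lemma radial_retraction_unit_ball (x : X) : unit_ball X (radial_retraction x).
Proof.
rewrite /unit_ball /closed_ball_ /= sub0r normrN normrZ ger0_norm; last first.
  by rewrite divr_ge0// ltW.
rewrite mulrAC ler_pdivrMr// mul1r mulr_natl mulr2n.
by rewrite (addrC 1) -addrA lerD2l -lerBlDl real_ler_norm // rpredB// realE.
Qed.

Lemma radial_retraction_id (x : X) : unit_ball X x -> radial_retraction x = x.
Proof.
rewrite /unit_ball /closed_ball_ /= sub0r normrN => x1.
rewrite /radial_retraction distrC ger0_norm ?subr_ge0//.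
by rewrite addrACA subrr addr0 divff ?scale1r// pnatr_eq0.
Qed.

Lemma radial_retraction_continuous : continuous radial_retraction.
Proof.
move=> x; apply: cvgZ; last exact: cvg_id.
apply: cvgM; first exact: cvg_cst.
apply: cvgV; first by rewrite gt_eqF.
apply: cvgD; first by apply: cvgD; [exact: cvg_cst|exact: norm_continuous].
apply: cvg_norm; apply: cvgB; [exact: norm_continuous|exact: cvg_cst].
Qed.

Lemma continuous_comp_retraction (h : X -> X) :
  {within unit_ball X, continuous h} -> continuous (h \o radial_retraction).
Proof.
move=> /subspace_continuousP h_cont x.
have := h_cont _ (radial_retraction_unit_ball x).
apply: cvg_comp => B wB.
have := radial_retraction_continuous wB.
rewrite /nbhs/=; apply: filterS => y; apply; exact: radial_retraction_unit_ball.
Qed.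

(** Given a scalar [a] and [u], [v] in the closure of [D], joint continuity of
[b *: u + v] lets one approximate [a] from [E] and [u], [v] from [D] at the same
time. *)
Lemma closure_submod (E : set K) (D : set X) : dense E ->
  D 0 -> (forall b u v, E b -> D u -> D v -> D (b *: u + v)) ->
  submod_closed [in closure D].
Proof.
move=> dE D0 Dlin; split; first by rewrite inE; exact: subset_closure.
move=> a u v; rewrite !inE => uY vY B nB.
have : (fun t : K * (X * X) => t.1 *: t.2.1 + t.2.2) @ nbhs (a, (u, v)) -->
    a *: u + v.
  apply: cvgD.
    apply: cvgZ; first exact: cvg_fst.
    by apply: cvg_comp; [exact: cvg_snd|exact: cvg_fst].
  by apply: cvg_comp; [exact: cvg_snd|exact: cvg_snd].
move=> /(_ _ nB) [[P Q] /= [nP [[Q1 Q2] /= [nQ1 nQ2] QS]] PQB].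
have [b [Pb Eb]] : P° `&` E !=set0.
  by apply: dE; [exists a|exact: open_interior].
have [u' [Du Qu]] := uY _ nQ1; have [v' [Dv Qv]] := vY _ nQ2.
exists (b *: u' + v'); split; first exact: Dlin.
apply: (PQB (b, (u', v'))); split; first exact: interior_subset.
by apply: QS.
Qed.

End NormedModule.

Theorem theorem3p2 (R : realType) (s : scalars)
    (X : completeNormedModType (scalar_field R s)) (f : X -> X)
    (f_homeo : homeomorphism_on (unit_ball X) (unit_ball X) f)
    (f_nonexp : nonexpansive_on (unit_ball X) f)
    (f_nonisom : ~ isometry_on (unit_ball X) f) :
  exists Y : set X,
    let BY := Y `&` unit_ball X in
    [/\ closed_subspace Y, separable_set Y, f @` BY = BY &
        [/\ homeomorphism_on BY BY f, nonexpansive_on BY f &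
            ~ isometry_on BY f]].
Proof.
have [[fB f_inj f_surj] f_cont [g [fK g_cont]]] := f_homeo.
have [x [y [Bx By fxy]]] : exists x y, [/\ unit_ball X x, unit_ball X y &
    `|f x - f y| <> `|x - y|].
  apply: contrapT => noxy; apply: f_nonisom => x y Bx By.
  by apply: contrapT => fxy; apply: noxy; exists x, y.
have gB z : unit_ball X z -> unit_ball X (g z) /\ f (g z) = z.
  by move=> /f_surj[t Bt <-]; rewrite fK ?inE.
have [E cE dE] := scalar_field_separable R s.
set r := @radial_retraction _ X.
(* the unary maps enter as binary operations ignoring their second argument *)
pose O : set (X -> X -> X) :=
  [set fun u _ => f (r u); fun u _ => g (r u)] `|`
  (fun b u v => b *: u + v) @` E.
have cO : countable O.
  apply: countable_setU; first exact: countable_setU.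
  exact: sub_countable (card_image_le _ _) cE.
have c0xy : countable [set 0; x; y] by apply: finite_set_countable.
have [D [cD AD DO]] := countable_closed_hull c0xy cO.
have fY z : closure D z -> closure D (f (r z)).
  apply: (@closure_stable _ (f \o r)); first exact: continuous_comp_retraction.
  by move=> t Dt; apply: (DO (fun u _ => f (r u)) t t) => //; left; left.
have gY z : closure D z -> closure D (g (r z)).
  apply: (@closure_stable _ (g \o r)); first exact: continuous_comp_retraction.
  by move=> t Dt; apply: (DO (fun u _ => g (r u)) t t) => //; left; right.
have fBY : f @` (closure D `&` unit_ball X) = closure D `&` unit_ball X.
  apply/seteqP; split => z.
    move=> [t [Yt Bt] <-]; split; last exact: fB.
    by rewrite -(radial_retraction_id Bt); exact: fY.
  move=> [Yz Bz]; have [Bgz fgz] := gB _ Bz; exists (g z) => //; split => //.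
  by rewrite -(radial_retraction_id Bz); exact: gY.
have DB := @subIsetr _ (closure D) (unit_ball X).
exists (closure D); split => //.
- split; first exact: closed_closure.
  apply: (closure_submod dE); first by apply: AD; left; left.
  move=> b u v Eb; apply: (DO (fun u v => b *: u + v)).
  by right; exists b.
- by exists D; split => //; exact: subset_closure.
split.
- split.
  + split.
    * by move=> u BYu; rewrite -fBY; exists u.
    * by move=> u v; rewrite !inE => -[_ Bu] [_ Bv]; apply: f_inj; rewrite inE.
    * by rewrite /set_surj fBY.
  + exact: (continuous_subspaceW DB) f_cont.
  + exists g; split; last exact: (continuous_subspaceW DB) g_cont.
    by move=> u; rewrite inE => -[_ Bu]; rewrite fK ?inE.
- by move=> [u v] /= [[_ Bu] [_ Bv]]; apply: (f_nonexp (u, v)).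
- move=> iso; apply: fxy; apply: iso; split => //; apply: subset_closure.
    by apply: AD; left; right.
  by apply: AD; right.
Qed.
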